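(* Suppose every activation function is ReLU, i.e. $\sigma_i(z)=\max\{0,z\}$ for $i=1,\dots,d-1$, and let $\mathcal{F}_{nn}$ be the class of depth-$d$ networks with parameter set $\mathcal{W}_F$. Then $$\inf_{\hat d(n,m)}\ \sup_{\mu,\nu\in\mathcal{P}_{B}}\mathbb{P}\left\{\left|d_{\mathcal{F}_{nn}}(\mu,\nu)-\hat d(n,m)\right|\ge 0.17\,\Gamma_{B}\prod_{i=1}^dM_F(i)\,\max\left(n^{-1/2},m^{-1/2}\right)\right\}\ge\frac14.$$ The same result holds when the parameter set is $\mathcal{W}_{1,\infty}$, with each $M_F(i)$ replaced by $M_{1,\infty}(i)$.
   Context: Fix integers $h\ge1$ (input dimension), $d\ge2$ (depth), layer widths $k_1=h,k_2,\dots,k_d\ge1$, and sample sizes $n,m\ge1$. For a matrix $\mathbf{W}$, $\|\mathbf{W}\|_F$ is the Frobenius norm and $\|\mathbf{W}\|_{1,\infty}$ is the maximal $\ell_1$ norm of its rows; $\|\cdot\|$ on vectors is the $\ell_2$ norm and $\|\cdot\|_1$ the $\ell_1$ norm. Networks: a depth-$d$ neural network is a function of the form $f(\mathbf{x})=\mathbf{w}_d^T\sigma_{d-1}(\mathbf{W}_{d-1}\sigma_{d-2}(\cdots\sigma_1(\mathbf{W}_1\mathbf{x})))$, $\mathbf{x}\in\mathbb{R}^h$, where $\mathbf{W}_i\in\mathbb{R}^{k_{i+1}\times k_i}$ for $i=1,\dots,d-1$, $\mathbf{w}_d\in\mathbb{R}^{k_d}$, and the $\sigma_i$ are applied entrywise.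 Given positive constants $M_F(i)$, $M_{1,\infty}(i)$, $i=1,\dots,d$, the parameter sets are: $\mathcal{W}_F$, all $(\mathbf{W}_1,\dots,\mathbf{W}_{d-1},\mathbf{w}_d)$ with $\|\mathbf{W}_i\|_F\le M_F(i)$ for $i\le d-1$ and $\|\mathbf{w}_d\|\le M_F(d)$; and $\mathcal{W}_{1,\infty}$, all such tuples with $\|\mathbf{W}_i\|_{1,\infty}\le M_{1,\infty}(i)$ for $i\le d-1$ and $\|\mathbf{w}_d\|_1\le M_{1,\infty}(d)$. $\mathcal{F}_{nn}$ is the set of all such networks with parameters in the given parameter set. Neural net distance: $d_{\mathcal{F}_{nn}}(\mu,\nu)=\sup_{f\in\mathcal{F}_{nn}}|\mathbb{E}_{\mathbf{x}\sim\mu}f(\mathbf{x})-\mathbb{E}_{\mathbf{x}\sim\nu}f(\mathbf{x})|$. Class $\mathcal{P}_B$: given $\Gamma_B>0$, $\mathcal{P}_B$ is the set of all Borel probability measures supported in $\{\mathbf{x}\in\mathbb{R}^h:\|\mathbf{x}\|\le\Gamma_B\}$. Minimax setting: $\mathbf{x}_1,\dots,\mathbf{x}_n$ are i.i.d. from $\mu$ and, independently, $\mathbf{y}_1,\dots,\mathbf{y}_m$ are i.i.d. from $\nu$; $\mathbb{P}=\mu^n\times\nu^m$ is the law of the samples. The infimum is over all estimators $\hat d(n,m)$, i.e. all real-valued measurable functions of the $n+m$ samples. *)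

(* Defs.v *)
From HB Require Import structures.
From mathcomp Require Import all_boot all_order all_algebra.
From mathcomp Require Import all_classical all_reals all_analysis.

Set Implicit Arguments.
Unset Strict Implicit.
Unset Printing Implicit Defensive.

Import Order.TTheory GRing.Theory Num.Theory.
Import numFieldNormedType.Exports.

Local Open Scope classical_set_scope.
Local Open Scope ring_scope.

Section norms.
Context (R : realType).

Definition norm2 (p : nat) (v : 'cV[R]_p) : R :=
  Num.sqrt (\sum_(i < p) v i 0 ^+ 2).

Definition norm1 (p : nat) (v : 'cV[R]_p) : R := \sum_(i < p) `|v i 0|.

Definition frobenius (p q : nat) (A : 'M[R]_(p, q)) : R :=
  Num.sqrt (\sum_(i < p) \sum_(j < q) A i j ^+ 2).

Definition norm_1_inf (p q : nat) (A : 'M[R]_(p, q)) : R :=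
  \big[Num.max/0]_(i < p) \sum_(j < q) `|A i j|.

End norms.

(* Layers are indexed from 0: k 0 is the input dimension, k i (i < d) are the
   widths, and a depth-d network consists of the matrices W_0, ..., W_(d-2),
   with W_i of size k (i+1) x k i, and of the output vector w of size k (d-1).
   The activation sigma i is applied to the output of W_i, the bound M i is that
   of W_i, and M (d-1) is that of w. Values at larger indices are irrelevant. *)
Section networks.
Context (R : realType) (k : nat -> nat).

Definition weights (l : nat) := forall i : 'I_l, 'M[R]_(k i.+1, k i).

Fixpoint hidden (sigma : nat -> R -> R) (l : nat) :
    weights l -> 'cV[R]_(k 0%N) -> 'cV[R]_(k l) :=
  match l return weights l -> 'cV[R]_(k 0%N) -> 'cV[R]_(k l) with
  | 0 => fun _ x => x
  | l'.+1 => fun W x =>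
      map_mx (sigma l')
        (W ord_max *m hidden sigma (fun i : 'I_l' => W (widen_ord (leqnSn l') i)) x)
  end.

Definition network (sigma : nat -> R -> R) (d : nat)
    (W : weights d.-1) (w : 'cV[R]_(k d.-1)) (x : 'cV[R]_(k 0%N)) : R :=
  (w^T *m hidden sigma W x) 0 0.

Definition W_F (d : nat) (M : nat -> R) : set (weights d.-1 * 'cV[R]_(k d.-1)) :=
  [set p | (forall i : 'I_d.-1, frobenius (p.1 i) <= M i) /\ norm2 p.2 <= M d.-1].

Definition W_1_inf (d : nat) (M : nat -> R) :
    set (weights d.-1 * 'cV[R]_(k d.-1)) :=
  [set p | (forall i : 'I_d.-1, norm_1_inf (p.1 i) <= M i) /\ norm1 p.2 <= M d.-1].

Definition nn_class (sigma : nat -> R -> R) (d : nat)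
    (Theta : set (weights d.-1 * 'cV[R]_(k d.-1))) : set ('cV[R]_(k 0%N) -> R) :=
  [set network sigma p.1 p.2 | p in Theta].

End networks.

Arguments W_F {R} k d M.
Arguments W_1_inf {R} k d M.

Section measures.
Context (R : realType).

Definition borel (h : nat) : measurableType (sigma_display (@open 'cV[R]_h)) :=
  g_sigma_algebraType (@open 'cV[R]_h).

Definition P_B (h : nat) (Gamma : R) : set (probability (borel h) R) :=
  [set mu | mu [set x | norm2 x <= Gamma] = 1%E].

Definition nn_dist (h : nat) (F : set ('cV[R]_h -> R))
    (mu nu : probability (borel h) R) : \bar R :=
  ereal_sup [set `|'E_mu[f] - 'E_nu[f]|%E | f in F].

End measures.

Section iid.
Context d (T : measurableType d) (R : realType).

Definition tuple_cons (n : nat) (x : T * n.-tuple T) : n.+1.-tuple T :=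
  [tuple of x.1 :: x.2].

Lemma measurable_tuple_cons n : measurable_fun setT (@tuple_cons n).
Proof. exact: measurable_cons. Qed.

HB.instance Definition _ n := isMeasurableFun.Build _ _ _ _ (@tuple_cons n)
  (@measurable_tuple_cons n).

Fixpoint iid (mu : probability T R) (n : nat) : probability (n.-tuple T) R :=
  match n return probability (n.-tuple T) R with
  | 0 => \d_([tuple] : 0.-tuple T)
  | n'.+1 => distribution (mu \x iid mu n')%E (@tuple_cons n')
  end.

Lemma iid_rectangle (mu : probability T R) n (A : 'I_n -> set T) :
  (forall i, measurable (A i)) ->
  iid mu n [set t | forall i, A i (tnth t i)] = (\prod_(i < n) mu (A i))%E.
Proof.
elim: n A => [|n IHn] A mA.
  by rewrite big_ord0 /= diracE mem_set// => -[].
have mB : measurable [set t : n.-tuple T | forall i, A (lift ord0 i) (tnth t i)].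
  rewrite (_ : [set t | _] =
      \bigcap_(i in [set: 'I_n]) (@tnth _ T ^~ i @^-1` A (lift ord0 i))).
    apply: fin_bigcap_measurable => // i _.
    by rewrite -[X in measurable X]setTI; exact: measurable_tnth.
  by apply/seteqP; split=> t /= At i; [move=> _|]; exact: At.
rewrite big_ord_recl -IHn// -product_measure1E//=.
rewrite /distribution /pushforward; congr (product_measure1 _ _ _).
apply/seteqP; split=> -[x t] /= At.
  split=> [|i]; first exact: (At ord0).
  by move: (At (lift ord0 i)); rewrite tnthS.
move=> i; case: (unliftP ord0 i) => [j|] ->; last by case: At.
by rewrite tnthS; case: At => _; exact.
Qed.

End iid.

Section minimax.
Context (R : realType) (h : nat).

Definition sample (n m : nat) := (n.-tuple (borel R h) * m.-tuple (borel R h))%type.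

Definition minimax_error_probability (F : set ('cV[R]_h -> R)) (Gamma : R)
    (n m : nat) (c : R) : \bar R :=
  ereal_inf [set
    ereal_sup [set
      (iid munu.1 n \x iid munu.2 m)%E
        [set s : sample n m |
          (c%:E <= `|nn_dist F munu.1 munu.2 - (dhat s)%:E|)%E]
      | munu in P_B Gamma `*` P_B Gamma]
    | dhat in [set dhat : sample n m -> R | measurable_fun setT dhat]].

End minimax.

Arguments minimax_error_probability {R h} F Gamma%_R n%_N m%_N c%_R.

(* Main.v *)
Require Import Defs.
From HB Require Import structures.
From mathcomp Require Import all_boot all_order all_algebra.
From mathcomp Require Import ring lra.
From mathcomp Require Import all_classical all_reals all_analysis.
From mathcomp Require Import measurable_realfun.

Set Implicit Arguments.
Unset Strict Implicit.
Unset Printing Implicit Defensive.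

Import Order.TTheory GRing.Theory Num.Theory.
Import numFieldNormedType.Exports.

Local Open Scope classical_set_scope.
Local Open Scope ring_scope.

(* Le Cam's method with two hypotheses. Take nu to be the Dirac mass at 0 and
   mu_a = a delta_p + (1 - a) delta_0 with p = Gamma e_0. A ReLU network vanishes
   at 0, so d(mu_a, nu) = a S with S = sup_f |f p|, and S >= Gamma * prod_i M i
   because of the network all of whose weight matrices are M i * E_00. For
   a_0 = 1/2 and a_1 = 1/2 + 0.34 / sqrt N, where N = min n m, the two distances
   are at least 0.34 Gamma * prod_i M i / sqrt N apart, while the chi-square
   divergence of the samples is at most (1 + 0.4624 / N)^N - 1 <= 1, which bounds
   their total variation by 1/2. If n > m, mu and nu are exchanged. *)

(** * Two-point laws, their powers, and a likelihood-ratio bound *)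

Section two_point.
Context {d} {T : measurableType d} {R : realType}.
Implicit Types (a : R) (p q : T).

Definition choose_point p q (b : bool) : T := if b then p else q.

Lemma measurable_choose_point p q : measurable_fun setT (choose_point p q).
Proof. by []. Qed.

HB.instance Definition _ p q := isMeasurableFun.Build _ _ _ _ (choose_point p q)
  (@measurable_choose_point p q).

(** Encoded as the image of a Bernoulli law, so it is a probability for every real [a]; it is used
    as [a delta_p + (1 - a) delta_q] only when [0 <= a <= 1]. *)
Definition two_point a p q : probability T R :=
  distribution (bernoulli_prob a) (choose_point p q).

Lemma two_point_eq1 a p q (A : set T) : A p -> A q -> two_point a p q A = 1%E.
Proof.
move=> Ap Aq; rewrite /two_point /distribution /pushforward /=.
rewrite (_ : _ @^-1` A = setT) ?probability_setT//.
by apply/seteqP; split=> // -[].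
Qed.

Lemma ge0_integral_two_point a p q (f : T -> \bar R) : 0 <= a <= 1 ->
  measurable_fun setT f -> (forall x, 0 <= f x)%E ->
  (\int[two_point a p q]_x f x = a%:E * f p + (1 - a)%:E * f q)%E.
Proof.
move=> a01 mf f0; rewrite ge0_integral_distribution// integral_bernoulli_prob//.
by move=> b; exact: f0.
Qed.

Lemma expectation_two_point a p q (f : T -> R) : 0 <= a <= 1 ->
  measurable_fun setT f -> f q = 0 ->
  ('E_(two_point a p q)[f] = (a * f p)%:E)%E.
Proof.
move=> a01 mf fq; rewrite unlock integralE.
have mEf : measurable_fun setT (EFin \o f) by exact/measurable_EFinP.
rewrite !ge0_integral_two_point//; last 2 first.
- exact: measurable_funeneg.
- exact: measurable_funepos.
rewrite !funeposE !funenegE /= fq.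
rewrite -!EFin_max -!EFinM -!EFinD; congr _%:E.
rewrite oppr0 maxxx.
by have [fp|fp] := leP 0 (f p); [rewrite max_r|rewrite max_l]; lra.
Qed.

Lemma measurable_tuple_cons_preimage n (A : set (n.+1.-tuple T)) :
  measurable A -> measurable (@tuple_cons _ T n @^-1` A).
Proof.
by move=> mA; rewrite -[X in measurable X]setTI; exact: measurable_tuple_cons.
Qed.

Lemma iid_dirac n q (A : set (n.-tuple T)) : measurable A ->
  iid (\d_q : probability T R) n A = (\d_[tuple of nseq n q] A : \bar R).
Proof.
elim: n A => [|n IHn] A mA.
  by rewrite /= (_ : [tuple] = [tuple of nseq 0 q])//; exact: val_inj.
have mA' := measurable_tuple_cons_preimage mA.
rewrite /= /distribution /pushforward /product_measure1 integral_dirac//; last first.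
  exact: measurable_fun_xsection.
rewrite diracT mul1e /= IHn; last exact: measurable_xsection.
rewrite !diracE; congr (_%:R%:E); congr (nat_of_bool _).
rewrite /xsection; apply/idP/idP; rewrite !inE /= ?inE /=;
by rewrite (_ : tuple_cons _ = [tuple of nseq n.+1 q])//; exact: val_inj.
Qed.

(** Conditioning on the first draw; this recursion replaces densities in the comparison of two
    powers. *)
Lemma iid_two_pointS a p q n (A : set (n.+1.-tuple T)) : 0 <= a <= 1 ->
  measurable A ->
  (iid (two_point a p q) n.+1 A =
   a%:E * iid (two_point a p q) n [set t | A (tuple_cons (p, t))] +
   (1 - a)%:E * iid (two_point a p q) n [set t | A (tuple_cons (q, t))])%E.
Proof.
move=> a01 mA.
have mA' := measurable_tuple_cons_preimage mA.
rewrite [LHS]/= /distribution /pushforward /product_measure1.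
rewrite ge0_integral_two_point//; last exact: measurable_fun_xsection.
congr (_ * _ + _ * _)%E; rewrite /=; congr (iid _ _ _);
  by apply/seteqP; split=> t; rewrite /xsection /= ?inE.
Qed.

Lemma measurable_tuple_cons_section n x (A : set (n.+1.-tuple T)) :
  measurable A -> measurable [set t | A (tuple_cons (x, t))].
Proof.
move=> mA; rewrite (_ : mkset _ = xsection (@tuple_cons _ T n @^-1` A) x).
  exact: measurable_xsection (measurable_tuple_cons_preimage mA).
by apply/seteqP; split=> t; rewrite /xsection /= ?inE.
Qed.

(* With L the likelihood ratio of the two laws, this is the integral of
   c L 1_A <= 1_A + (c L)^2 / 4. In the induction, c absorbs the likelihood ratio
   of the coordinate that is split off. *)
Lemma iid_two_point_le a p q n (c : R) (A : set (n.-tuple T)) : 0 <= a <= 1 ->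
  measurable A ->
  (c%:E * iid (two_point a p q) n A <= iid (two_point (1 / 2) p q) n A +
     (c ^+ 2 / 4 * (2 * (a ^+ 2 + (1 - a) ^+ 2)) ^+ n)%:E)%E.
Proof.
move=> a01; have h01 : 0 <= (1 / 2 : R) <= 1 by lra.
elim: n c A => [|n IHn] c A mA.
  rewrite /= diracE -EFinM -EFinD lee_fin expr0.
  (* On [A] the claim is [(c / 2 - 1)^2 >= 0]; off [A] it is [c^2 >= 0]. *)
  have := sqr_ge0 c; have := sqr_ge0 (c / 2 - 1).
  by case: (_ \in A); rewrite /= ?mulr1n ?mulr0n; nra.
rewrite !iid_two_pointS//.
(* The likelihood ratios of one draw against weight 1/2 are [2 a] at [p] and [2 (1 - a)] at [q]. The
   average of the two instances is the claim. *)
have IHp := IHn (2 * a * c) _ (measurable_tuple_cons_section p mA).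
have IHq := IHn (2 * (1 - a) * c) _ (measurable_tuple_cons_section q mA).
have iid_fin b x : exists r : R,
    iid (two_point b p q) n [set t | A (tuple_cons (x, t))] = r%:E.
  exists (fine (iid (two_point b p q) n [set t | A (tuple_cons (x, t))])).
  by rewrite fineK// fin_num_measure//; exact: measurable_tuple_cons_section.
have [u uE] := iid_fin a p; have [v vE] := iid_fin a q.
have [w wE] := iid_fin (1 / 2) p; have [z zE] := iid_fin (1 / 2) q.
move: IHp IHq; rewrite uE vE wE zE -!EFinM -!EFinD !lee_fin (exprS _ n).
set r := (X in X ^+ n); move: (r ^+ n) => s hp hq.
rewrite /r; lra.
Qed.

End two_point.

(** * The perturbed hypothesis and its chi-square divergence *)

Section perturbed_weight.
Context {R : realType}.

Definition perturbed_weight (N : nat) : R := 1 / 2 + 34 / 100 / Num.sqrt N%:R.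

Lemma perturbed_weight_itv N : (0 < N)%N -> 0 <= perturbed_weight N <= 1.
Proof.
move=> N0; have s1 : 1 <= Num.sqrt (N%:R : R).
  by rewrite -[leLHS]sqrtr1 ler_wsqrtr// ler1n.
have /andP[v0 v1] : 0 <= (Num.sqrt (N%:R : R))^-1 <= 1.
  by rewrite invr_ge0 sqrtr_ge0 invf_le1// (lt_le_trans _ s1).
rewrite /perturbed_weight; lra.
Qed.

(** The base is the second moment of the likelihood ratio of one draw, and equals
    [1 + 4 (a - 1/2)^2] for [a] the perturbed weight. *)
Lemma chi_square_perturbed_weight N : (0 < N)%N ->
  (2 * (perturbed_weight N ^+ 2 + (1 - perturbed_weight N) ^+ 2)) ^+ N <= 2.
Proof.
move=> N0; have Npos : 0 < (N%:R : R) by rewrite ltr0n.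
have N1 : 1 <= (N%:R : R) by rewrite ler1n.
(* [289 / 625 = 4 * (34 / 100)^2]. As it is below 1/2, the final bound [1 / (1 - e)] is below 2. *)
have [e eE] : exists e : R, e = 289 / 625 by eexists.
have e0 : 0 <= e by lra.
have [y yE] : exists y, y = e / N%:R by eexists.
have -> : 2 * (perturbed_weight N ^+ 2 + (1 - perturbed_weight N) ^+ 2) = 1 + y.
  have v2 : (Num.sqrt (N%:R : R))^-1 ^+ 2 = N%:R^-1.
    by rewrite exprVn sqr_sqrtr// ltW.
  rewrite yE eE /perturbed_weight -v2; move: (Num.sqrt _)^-1 => v.
  by field.
have yN : y * N%:R = e by rewrite yE divfK// gt_eqF.
have y0 : 0 <= y by rewrite yE divr_ge0// ltW.
have y1 : y <= e by rewrite -yN ler_peMr.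
(* Bernoulli: (1 + y)^N <= 1 / (1 - y)^N <= 1 / (1 - N y) *)
have bern : 1 - y * N%:R <= (1 - y) ^+ N.
  have : forall k, 1 - y * k%:R <= (1 - y) ^+ k.
    elim=> [|k IHk]; first by rewrite expr0 mulr0 subr0.
    rewrite exprS -natr1; apply: (le_trans _ (ler_wpM2l _ IHk)); last by lra.
    have : 0 <= (k%:R : R) by [].
    nra.
  exact.
have prod_le1 : (1 + y) ^+ N * (1 - y) ^+ N <= 1.
  rewrite -exprMn exprn_ile1//; nra.
move: bern; rewrite yN eE => /(ler_wpM2l (exprn_ge0 N (addr_ge0 ler01 y0))).
lra.
Qed.

Context d (T : measurableType d).

(** The case [c = 1] of [iid_two_point_le], whose error term is then at most [2 / 4]. *)
Lemma iid_perturbed_le (p q : T) N (A : set (N.-tuple T)) : (0 < N)%N ->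
  measurable A ->
  (iid (two_point (perturbed_weight N) p q) N A <=
   iid (two_point (1 / 2) p q) N A + (1 / 2)%:E)%E.
Proof.
move=> N0 mA; have := iid_two_point_le p q 1 (perturbed_weight_itv N0) mA.
rewrite mul1e => /le_trans; apply; rewrite leeD2l// lee_fin.
have := chi_square_perturbed_weight N0; lra.
Qed.

End perturbed_weight.

(** * Product laws in which one sample is deterministic *)

Section product_iid_dirac.
Local Open Scope ereal_scope.
Context {R : realType} {d1 d2} {T1 : measurableType d1} {T2 : measurableType d2}.

Lemma product_iid_dirac (mu : probability T1 R) (q : T2) m
    (E : set (T1 * m.-tuple T2)) : measurable E ->
  (mu \x iid (\d_q : probability T2 R) m) E =
  mu (ysection E [tuple of nseq m q]).
Proof.
move=> mE; rewrite /product_measure1.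
transitivity (\int[mu]_x (\1_(ysection E [tuple of nseq m q]) x)%:E).
  apply: eq_integral => x _ /=; rewrite iid_dirac; last exact: measurable_xsection.
  by rewrite diracE indicE mem_xsection mem_ysection.
by rewrite integral_indic ?setIT//; exact: measurable_ysection.
Qed.

Lemma iid_dirac_product (q : T1) n (nu : probability T2 R)
    (E : set (n.-tuple T1 * T2)) : measurable E ->
  (iid (\d_q : probability T1 R) n \x nu) E =
  nu (xsection E [tuple of nseq n q]).
Proof.
move=> mE; rewrite /product_measure1.
(* Here the Dirac power is the outer measure of the iterated integral, so it is the measure, not the
   integrand, that is replaced. *)
rewrite (eq_measure_integral (\d_[tuple of nseq n q] : {measure set _ -> \bar R})).
  rewrite integral_dirac//; last exact: measurable_fun_xsection.
  by rewrite diracT mul1e.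
by move=> A mA _; exact: iid_dirac.
Qed.

End product_iid_dirac.

(** * Le Cam's two-hypothesis bound *)

Section le_cam.
Local Open Scope ereal_scope.
Context {R : realType} (h n m : nat) (F : set ('cV[R]_h -> R)) (Gamma c : R).

(** By separation the error events [E0] and [E1] cover the sample space, so [1 <= P1 E0 + P1 E1 <=
    P0 E0 + 1/2 + P1 E1 <= 2 S + 1/2], where [S] is the worst-case error probability. *)
Lemma le_cam_two_point (mu0 nu0 mu1 nu1 : probability (borel R h) R) :
  P_B Gamma mu0 -> P_B Gamma nu0 -> P_B Gamma mu1 -> P_B Gamma nu1 ->
  (forall y : R, c%:E <= `|nn_dist F mu0 nu0 - y%:E| \/
                 c%:E <= `|nn_dist F mu1 nu1 - y%:E|) ->
  (forall E, measurable E ->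
    (iid mu1 n \x iid nu1 m) E <= (iid mu0 n \x iid nu0 m) E + (1 / 2)%:E) ->
  (1 / 4)%:E <= minimax_error_probability F Gamma n m c.
Proof.
move=> B0 B0' B1 B1' sep tv; apply/ereal_infP => _ [dhat mdhat <-].
set E0 := [set s | c%:E <= `|nn_dist F mu0 nu0 - (dhat s)%:E|].
set E1 := [set s | c%:E <= `|nn_dist F mu1 nu1 - (dhat s)%:E|].
have mE (x : \bar R) : measurable [set s | c%:E <= `|x - (dhat s)%:E|].
  rewrite -[X in measurable X]setTI; apply: emeasurable_fun_c_infty => //.
  apply: measurableT_comp => //; apply: emeasurable_funB => //.
  exact/measurable_EFinP.
have E01 : E0 `|` E1 = setT.
  by apply/seteqP; split=> // s _; exact: (sep (dhat s)).
set P0 := iid mu0 n \x iid nu0 m; set P1 := iid mu1 n \x iid nu1 m.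
set S := ereal_sup _.
have P0S : P0 E0 <= S by apply: ereal_sup_ubound; exists (mu0, nu0).
have P1S : P1 E1 <= S by apply: ereal_sup_ubound; exists (mu1, nu1).
have P1T : P1 setT = 1.
  rewrite /P1 -setXTT product_measure1E//.
  by rewrite -[RHS]mul1e; congr (_ * _); exact: probability_setT.
have le1 : 1 <= P1 E0 + P1 E1.
  pose Q : {measure set (n.-tuple (borel R h) * m.-tuple (borel R h)) -> \bar R} :=
    iid mu1 n \x iid nu1 m.
  have QU : Q (E0 `|` E1) <= Q E0 + Q E1.
    by apply: measureU2; exact: mE.
  by move: QU; rewrite E01 [X in X <= _]P1T.
have le2 : 1 <= S + (1 / 2)%:E + S.
  apply: (le_trans le1); apply: leeD => //.
  by apply: (le_trans (tv _ (mE _))); rewrite leeD2r.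
case: S le2 {P0S P1S} => [s| |] //=.
- by rewrite -!EFinD !lee_fin; lra.
- by move=> _; rewrite leey.
Qed.

End le_cam.

(** * Lower bound for a class of functions vanishing at 0 *)

Section two_point_lower_bound.
Context {R : realType} (h n m : nat) (F : set ('cV[R]_h -> R)).
Context (Gamma V : R) (p : 'cV[R]_h).
Hypothesis mF : forall f, F f -> measurable_fun setT (f : borel R h -> R).
Hypothesis F0 : forall f, F f -> f 0 = 0.

Let S : \bar R := ereal_sup [set `|f p|%:E | f in F].

Let x0 : borel R h := (0 : 'cV[R]_h).
Let x1 : borel R h := p.
Let dirac0 : probability (borel R h) R := \d_x0.

Lemma expectation_two_point_dirac (a : R) f : 0 <= a <= 1 -> F f ->
  ('E_(two_point a x1 x0)[f] = (a * f p)%:E)%E /\ ('E_dirac0[f] = 0%:E)%E.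
Proof.
move=> a01 Ff; rewrite expectation_two_point ?F0//; last exact: mF.
split=> //; rewrite unlock integral_dirac//; last first.
  by apply/measurable_EFinP; exact: mF.
by rewrite F0// mule0.
Qed.

(** Each [f] contributes [a * |f p|], and the factor [a >= 0] leaves the supremum of a nonempty
    set. *)
Lemma nn_dist_two_pointl (a : R) : 0 <= a <= 1 -> F !=set0 ->
  nn_dist F (two_point a x1 x0) dirac0 = (a%:E * S)%E.
Proof.
move=> a01 [f0 Ff0]; have /andP[a0 _] := a01.
rewrite -ereal_supZl//; last by apply/set0P; exists (`|f0 p|%:E), f0.
rewrite /nn_dist image_comp; congr ereal_sup; apply: eq_imagel => f Ff /=.
have [-> ->] := expectation_two_point_dirac a01 Ff.
by rewrite sube0 abse_EFin normrM ger0_norm// EFinM.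
Qed.

Lemma nn_dist_two_pointr (a : R) : 0 <= a <= 1 -> F !=set0 ->
  nn_dist F dirac0 (two_point a x1 x0) = (a%:E * S)%E.
Proof.
move=> a01 F_neq0; rewrite -nn_dist_two_pointl// /nn_dist.
congr ereal_sup; apply: eq_imagel => f Ff /=.
have [-> ->] := expectation_two_point_dirac a01 Ff.
by rewrite sube0 sub0e abseN.
Qed.

Hypothesis VS : exists2 f, F f & V <= `|f p|.

Let F_neq0 : F !=set0.
Proof. by have [f Ff _] := VS; exists f. Qed.

Let N := minn n m.

(* S = +oo is not excluded: the error of any real estimate is then +oo. *)
Lemma two_point_separation (y : R) : (0 < N)%N -> 0 <= V ->
  let c := (17 / 100 * V * (Num.sqrt N%:R)^-1)%R in
  (c%:E <= `|(1 / 2)%:E * S - y%:E|)%E \/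
  (c%:E <= `|(perturbed_weight N)%:E * S - y%:E|)%E.
Proof.
move=> N0 V0 /=; have [f Ff Vf] := VS.
have : (V%:E <= S)%E.
  by apply: (@le_trans _ _ `|f p|%:E); [rewrite lee_fin|apply: ereal_sup_ubound; exists f].
case: S => [s| |]; last 2 first.
- by move=> _; left; rewrite gt0_muley// leey.
- by rewrite leeNy_eq.
rewrite lee_fin => Vs; rewrite -!EFinM -!EFinB !abse_EFin !lee_fin.
(* If both errors were below the threshold, the two distances would differ by less than
   [34/100 * V / sqrt N]; they differ by [34/100 * s / sqrt N] with [V <= s]. *)
apply/orP; rewrite -[_ || _]negbK negb_or -!ltNge !ltr_norml.
apply/negP => /andP[/andP[h1 h2] /andP[h3 h4]].
move: h1 h2 h3 h4; rewrite /perturbed_weight.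
have : 0 <= (Num.sqrt (N%:R : R))^-1 by rewrite invr_ge0 sqrtr_ge0.
move: (Num.sqrt _)^-1 => v v0.
have := ler_wpM2r v0 Vs.
lra.
Qed.

Lemma two_point_minimax : (0 < n)%N -> (0 < m)%N -> 0 <= V ->
  norm2 p <= Gamma ->
  ((1 / 4)%:E <= minimax_error_probability F Gamma n m
     (17 / 100 * V * Num.max (Num.sqrt n%:R)^-1 (Num.sqrt m%:R)^-1)%R)%E.
Proof.
move=> n0 m0 V0 pG; have N0 : (0 < N)%N by rewrite leq_min n0.
have zeroG : norm2 (0 : 'cV[R]_h) <= Gamma.
  apply: le_trans pG; rewrite /norm2 big1 ?sqrtr0 ?sqrtr_ge0// => i _.
  by rewrite mxE expr0n.
have B a : P_B Gamma (two_point a x1 x0) by exact: two_point_eq1.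
have B0 : P_B Gamma dirac0 by rewrite /P_B /= diracE mem_set.
have half01 : 0 <= (1 / 2 : R) <= 1 by lra.
have pert01 := @perturbed_weight_itv R _ N0.
have le_inv_sqrt i j : (0 < i)%N -> (i <= j)%N ->
    (Num.sqrt (j%:R : R))^-1 <= (Num.sqrt i%:R)^-1.
  move=> i0 ij; have j0 := leq_trans i0 ij.
  by rewrite lef_pV2 ?posrE ?sqrtr_gt0 ?ltr0n// ler_wsqrtr// ler_nat.
have -> : Num.max (Num.sqrt n%:R)^-1 (Num.sqrt m%:R)^-1 = (Num.sqrt N%:R)^-1 :> R.
  by rewrite /N; have [nm|/ltnW mn] := leqP n m; [apply: max_l|apply: max_r];
    exact: le_inv_sqrt.
have sep y := @two_point_separation y N0 V0.
(* The two-point law is placed on the side with fewer draws; the other sample is constant, so only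
   [N] draws are informative. *)
have [nm|/ltnW mn] := leqP n m.
- apply: (@le_cam_two_point _ _ _ _ _ _ _ (two_point (1 / 2) x1 x0)
    dirac0 (two_point (perturbed_weight N) x1 x0) dirac0) => //.
    by move=> y; rewrite !nn_dist_two_pointl//; exact: sep.
  move=> E mE; rewrite !product_iid_dirac// /N (minn_idPl nm).
  by apply: iid_perturbed_le => //; exact: measurable_ysection.
- apply: (@le_cam_two_point _ _ _ _ _ _ _ dirac0
    (two_point (1 / 2) x1 x0) dirac0
    (two_point (perturbed_weight N) x1 x0)) => //.
    by move=> y; rewrite !nn_dist_two_pointr//; exact: sep.
  move=> E mE; rewrite !iid_dirac_product// /N (minn_idPr mn).
  by apply: iid_perturbed_le => //; exact: measurable_xsection.
Qed.

End two_point_lower_bound.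

(** * Measurability of networks, and an explicit ReLU network *)

Section relu_networks.
Context {R : realType} (k : nat -> nat).
Implicit Types (sigma : nat -> R -> R) (l d : nat).

(** Coordinates are continuous, so preimages of open intervals are open and hence Borel. *)
Lemma measurable_coord h (i : 'I_h) :
  measurable_fun setT (fun x : borel R h => (x : 'cV[R]_h) i 0).
Proof.
apply: (measurability _ (RGenOpens.measurableE R)) => _ [_ [a [b ->]] <-].
rewrite setTI; apply: sub_sigma_algebra.
apply: open_comp; last exact: interval_open.
by move=> x _; exact: coord_continuous.
Qed.

(** Stated per coordinate, so that the intermediate layers need no sigma-algebra. *)
Lemma measurable_hidden sigma l (W : weights R k l) (i : 'I_(k l)) :
  (forall j, (j < l)%N -> measurable_fun setT (sigma j)) ->
  measurable_fun setT (fun x : borel R (k 0%N) => hidden sigma W x i 0).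
Proof.
elim: l W i => [|l IHl] W i msigma; first exact: measurable_coord.
rewrite (_ : (fun x => _) = sigma l \o (fun x : borel R (k 0%N) =>
    \sum_j W ord_max i j *
      hidden sigma (fun i : 'I_l => W (widen_ord (leqnSn l) i)) x j 0)); last first.
  by apply/funext => x /=; rewrite !mxE.
apply: measurableT_comp; first exact: msigma.
apply: measurable_sum => j; apply: measurable_funM => //.
by apply: IHl => j' j'l; apply: msigma; exact: ltnW.
Qed.

Lemma measurable_network sigma d (W : weights R k d.-1) (w : 'cV[R]_(k d.-1)) :
  (forall j, (j < d.-1)%N -> measurable_fun setT (sigma j)) ->
  measurable_fun setT (network sigma W w : borel R (k 0%N) -> R).
Proof.
move=> msigma; rewrite (_ : network _ _ _ = fun x : borel R (k 0%N) =>
    \sum_j w j 0 * hidden sigma W x j 0); last first.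
  by apply/funext => x; rewrite /network mxE; apply: eq_bigr => j _; rewrite mxE.
apply: measurable_sum => j; apply: measurable_funM => //.
exact: measurable_hidden.
Qed.

Lemma hidden0 sigma l (W : weights R k l) :
  (forall j, (j < l)%N -> sigma j 0 = 0) -> hidden sigma W 0 = 0.
Proof.
elim: l W => [//|l IHl] W sigma0 /=.
rewrite IHl ?mulmx0; last by move=> j jl; apply: sigma0; exact: ltnW.
by apply/matrixP => i j; rewrite !mxE sigma0.
Qed.

(** [pid_mx 1] is the matrix unit at (0, 0), and the first basis vector when it is a column. *)
Definition pid_weights (M : nat -> R) l : weights R k l :=
  fun i => M i *: pid_mx 1.
Arguments pid_weights : clear implicits.

(** The signal stays on the first axis with a nonnegative coefficient, where ReLU is the
    identity. *)
Lemma hidden_pid_mx sigma l (M : nat -> R) (c : R) :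
  (forall j, (j < l)%N -> forall z, sigma j z = Num.max 0 z) ->
  (forall j, (j < l)%N -> 0 <= M j) ->
  (forall j, (j <= l)%N -> (0 < k j)%N) -> 0 <= c ->
  hidden sigma (pid_weights M l) (c *: pid_mx 1) =
  (c * \prod_(i < l) M i) *: pid_mx 1.
Proof.
move=> + + + c0.
elim: l => [|l IHl] relu M0 k0; first by rewrite big_ord0 mulr1.
rewrite /= (_ : (fun i : 'I_l => _) = pid_weights M l)// IHl; last 3 first.
- by move=> j jl; apply: relu; exact: ltnW.
- by move=> j jl; apply: M0; exact: ltnW.
- by move=> j jl; apply: k0; exact: ltnW.
(* Positive widths give [pid_mx 1 *m pid_mx 1 = pid_mx 1]; an empty layer would give 0. *)
rewrite -scalemxAl -scalemxAr mul_pid_mx !(minn_idPr _)// ?k0//.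
rewrite scalerA big_ord_recr /= mulrCA [M l * _]mulrC.
apply/matrixP => i j; rewrite !mxE relu//; apply/max_r.
rewrite !mulr_ge0 ?ler0n ?M0// prodr_ge0// => s _.
by apply: M0; apply: ltnW; rewrite ltnS.
Qed.

Lemma network_pid_mx sigma d (M : nat -> R) (c : R) : (0 < d)%N ->
  (forall j, (j < d.-1)%N -> forall z, sigma j z = Num.max 0 z) ->
  (forall j, (j < d)%N -> 0 <= M j) ->
  (forall j, (j < d)%N -> (0 < k j)%N) -> 0 <= c ->
  network sigma (pid_weights M d.-1) (M d.-1 *: pid_mx 1)
    (c *: pid_mx 1) = c * \prod_(i < d) M i.
Proof.
case: d => [//|d] _ /= relu M0 k0 c0; rewrite /network.
rewrite hidden_pid_mx//; last by move=> j jd; apply: M0; exact: ltnW.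
rewrite [(_ *: _)^T]linearZ /= tr_pid_mx -scalemxAl -scalemxAr mul_pid_mx.
rewrite !(minn_idPr _)// ?k0//.
by rewrite !mxE eqxx mulr1 big_ord_recr /=; ring.
Qed.

End relu_networks.

Arguments pid_weights {R} k M l.

(** * Norms of scaled matrix units *)

Section pid_mx_norms.
Context {R : realType}.
Implicit Types (p q : nat) (c : R).

(** The function [g] is later the square or the absolute value, which covers all four norms.
    Equality fails only when [q = 0] leaves an empty sum. *)
Lemma sum_row_scale_pid_mx p q c (g : R -> R) (i : 'I_p) : g 0 = 0 -> 0 <= g c ->
  \sum_(j < q) g ((c *: pid_mx 1 : 'M[R]_(p, q)) i j) <= g c *+ (i == 0%N :> nat).
Proof.
move=> g0 gc; case: q => [|q]; first by rewrite big_ord0 mulrn_wge0.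
rewrite (bigD1 ord0)//= big1 ?addr0 => [|j j0].
  rewrite !mxE; have [->|i0] := eqVneq (i : nat) 0%N; first by rewrite mulr1.
  by rewrite mulr0 g0.
rewrite !mxE; have [ij|] := eqVneq (i : nat) j; last by rewrite mulr0.
by rewrite ij ltnS leqn0 (negbTE (j0 : (j : nat) != 0%N)) andbF mulr0.
Qed.

Lemma sum_scale_pid_mx p q c (g : R -> R) : g 0 = 0 -> 0 <= g c ->
  \sum_(i < p) \sum_(j < q) g ((c *: pid_mx 1 : 'M[R]_(p, q)) i j) <= g c.
Proof.
move=> g0 gc; apply: (le_trans (ler_sum _ (fun i _ => sum_row_scale_pid_mx _ i g0 gc))).
case: p => [|p]; first by rewrite big_ord0.
rewrite (bigD1 ord0)//= big1 ?addr0// => i i0.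
by rewrite (_ : (i : nat) == 0%N = false)//; exact/negbTE.
Qed.

Lemma sum_col_scale_pid_mx p c (g : R -> R) : g 0 = 0 -> 0 <= g c ->
  \sum_(i < p) g ((c *: pid_mx 1 : 'cV[R]_p) i 0) <= g c.
Proof.
move=> g0 gc; apply: le_trans (sum_scale_pid_mx p 1 g0 gc).
by apply: ler_sum => i _; rewrite big_ord1.
Qed.

Lemma frobenius_scale_pid_mx p q c : 0 <= c ->
  frobenius (c *: pid_mx 1 : 'M[R]_(p, q)) <= c.
Proof.
move=> c0; rewrite /frobenius -[leRHS](ger0_norm c0) -sqrtr_sqr ler_wsqrtr//.
by apply: (@sum_scale_pid_mx p q c (fun z : R => z ^+ 2)); rewrite ?expr0n ?sqr_ge0.
Qed.

Lemma norm2_scale_pid_mx p c : 0 <= c -> norm2 (c *: pid_mx 1 : 'cV[R]_p) <= c.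
Proof.
move=> c0; rewrite /norm2 -[leRHS](ger0_norm c0) -sqrtr_sqr ler_wsqrtr//.
by apply: (@sum_col_scale_pid_mx p c (fun z : R => z ^+ 2)); rewrite ?expr0n ?sqr_ge0.
Qed.

Lemma norm_1_inf_scale_pid_mx p q c : 0 <= c ->
  norm_1_inf (c *: pid_mx 1 : 'M[R]_(p, q)) <= c.
Proof.
move=> c0; apply: bigmax_le => // i _; rewrite -[leRHS](ger0_norm c0).
apply: (le_trans (@sum_row_scale_pid_mx p q c Num.norm i _ _)).
- exact: normr0.
- exact: normr_ge0.
- by case: eqP; rewrite ?mulr0n ?normr_ge0.
Qed.

Lemma norm1_scale_pid_mx p c : 0 <= c -> norm1 (c *: pid_mx 1 : 'cV[R]_p) <= c.
Proof.
move=> c0; rewrite /norm1 -[leRHS](ger0_norm c0).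
by apply: (@sum_col_scale_pid_mx p c Num.norm); rewrite ?normr0 ?normr_ge0.
Qed.

End pid_mx_norms.

(** The parameter set enters only through its containing the explicit network, whose value at
    [Gamma e_0] is [Gamma * prod_i M i]; both norms are thus treated at once. *)
Lemma relu_minimax {R : realType} (d : nat) (k : nat -> nat) (n m : nat)
    (sigma : nat -> R -> R) (M : nat -> R) (Gamma : R)
    (Theta : set (weights R k d.-1 * 'cV[R]_(k d.-1))) :
  (0 < d)%N -> (forall i, (i < d)%N -> (0 < k i)%N) ->
  (0 < n)%N -> (0 < m)%N ->
  (forall i, (i < d.-1)%N -> forall z, sigma i z = Num.max 0 z) ->
  (forall i, (i < d)%N -> 0 <= M i) -> 0 <= Gamma ->
  Theta (pid_weights k M d.-1, M d.-1 *: pid_mx 1) ->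
  ((1 / 4)%:E <= minimax_error_probability (nn_class sigma Theta) Gamma n m
    (17 / 100 * Gamma * \prod_(i < d) M i *
      Num.max (Num.sqrt n%:R)^-1 (Num.sqrt m%:R)^-1)%R)%E.
Proof.
move=> d0 k0 n0 m0 relu M0 Gamma0 Theta_pid.
have prod0 : 0 <= Gamma * \prod_(i < d) M i.
  by rewrite mulr_ge0// prodr_ge0// => i _; exact: M0.
rewrite -(mulrA (17 / 100)).
apply: (@two_point_minimax _ _ _ _ _ _ _ (Gamma *: pid_mx 1)) => //.
- move=> _ [[W w] _ <-]; apply: measurable_network => j jd.
  by rewrite (_ : sigma j = Num.max 0)//; [exact: measurable_maxr|exact/funext/relu].
- move=> _ [[W w] _ <-]; rewrite /network hidden0 ?mulmx0 ?mxE// => j jd.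
  by rewrite relu// maxxx.
- exists (network sigma (pid_weights k M d.-1) (M d.-1 *: pid_mx 1)).
    by exists (pid_weights k M d.-1, M d.-1 *: pid_mx 1).
  by rewrite network_pid_mx// ger0_norm.
- exact: norm2_scale_pid_mx.
Qed.

Theorem corollary2 (R : realType) (d : nat) (k : nat -> nat) (n m : nat)
    (sigma : nat -> R -> R) (M_F M_1 : nat -> R) (Gamma_B : R)
    (hd : (2 <= d)%N)
    (hk : forall i, (i < d)%N -> (1 <= k i)%N)
    (hn : (1 <= n)%N) (hm : (1 <= m)%N)
    (hsigma : forall i, (i < d.-1)%N -> forall z, sigma i z = Num.max 0 z)
    (hMF : forall i, (i < d)%N -> 0 < M_F i)
    (hM1 : forall i, (i < d)%N -> 0 < M_1 i)
    (hGamma : 0 < Gamma_B) :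
  ((1 / 4)%:E <=
    minimax_error_probability (nn_class sigma (W_F k d M_F))
      Gamma_B n m
      (17 / 100 * Gamma_B * \prod_(i < d) M_F i *
        Num.max (Num.sqrt n%:R)^-1 (Num.sqrt m%:R)^-1)%R)%E
  /\
  ((1 / 4)%:E <=
    minimax_error_probability (nn_class sigma (W_1_inf k d M_1))
      Gamma_B n m
      (17 / 100 * Gamma_B * \prod_(i < d) M_1 i *
        Num.max (Num.sqrt n%:R)^-1 (Num.sqrt m%:R)^-1)%R)%E.
Proof.
have d0 : (0 < d)%N by exact: ltnW.
have pred_lt i : (i < d.-1)%N -> (i < d)%N by move/leq_trans; apply; exact: leq_pred.
have last_lt : (d.-1 < d)%N by rewrite prednK.
(* What depends on the norm is that the explicit weights obey the bounds. *)
split; apply: relu_minimax => //; try exact: ltW.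
- by move=> i /hMF/ltW.
- split=> [i|] /=; [apply: frobenius_scale_pid_mx|apply: norm2_scale_pid_mx].
    by apply/ltW/hMF/pred_lt.
  exact/ltW/hMF.
- by move=> i /hM1/ltW.
- split=> [i|] /=; [apply: norm_1_inf_scale_pid_mx|apply: norm1_scale_pid_mx].
    by apply/ltW/hM1/pred_lt.
  exact/ltW/hM1.
Qed.
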